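(* Let the reference delay distribution $h$, with mean value $\bar\tau$, and the quantities $p_\mu$, $\mu\ge 0$, be as in the context. For delay distributions that are symmetrically distributed about their mean value, that is, such that $h'(\bar\tau+\theta)=h'(\bar\tau-\theta)$, where the derivative exists a.e. by assumption, one has $$|p_\mu|\le|p_0|\quad\text{for all }\mu>0.$$
   Context: The reference distribution $h$ is a probability distribution with compact support, that is, a monotone function on $\mathbb{R}$ satisfying $$\int_{-\infty}^{\infty}dh(\theta)=1,\quad\int_{-\infty}^{\infty}\theta\,dh(\theta)=\bar\tau,\quad\int_{-\infty}^{\infty}(\theta-\bar\tau)^2\,dh(\theta)=\sigma^2 .$$ For $\mu>0$ define $h_\mu(\theta)=h(\bar\tau+(\theta-\bar\tau)/\mu)$ (a distribution with mean $\bar\tau$ and variance $\mu^2\sigma^2$) and $$\alpha_\mu=\int_{-\infty}^{\infty}\cos\theta\,dh_\mu(\theta),\qquad \beta_\mu=\int_{-\infty}^{\infty}\sin\theta\,dh_\mu(\theta).$$ For $\mu=0$ define $\alpha_0=\cos\bar\tau$, $\beta_0=\sin\bar\tau$, the values for a discrete delay at $\bar\tau$ (equivalently, $h_0$ is a Heaviside step function at $\bar\tau$). Let $$J=\begin{pmatrix}0&-1\\1&0\end{pmatrix},$$ and, for a fixed $2\times2$ matrix $\hat C$, set $$p_\mu=\alpha_\mu\operatorname{tr}(\hat C)+\beta_\mu\operatorname{tr}(J\hat C),\qquad \mu\ge 0,$$ where $\operatorname{tr}$ is the matrix trace. The matrix $\hat C$ is $\hat C=\Psi^{\top}(0)C\Phi(0)$,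 where $C\in\mathbb{R}^{n\times n}$ is the structure matrix of a linearized delayed feedback $\phi\mapsto C\int\phi(\theta)\,dh(\theta)$ acting on a perturbation of a linear functional differential equation $\dot x(t)=\int_{-\tau}^{0}d\eta(\theta)x(t+\theta)$ in $\mathbb{R}^n$; here $\eta$ is an $n\times n$ matrix with components of bounded variation on $[-\tau,0]$, and the linear equation has a pair of characteristic values $\pm i$ and all its other characteristic values have negative real parts. $\Phi$ is an $n\times 2$ matrix whose columns span the eigenspace of this linear equation corresponding to $\pm i$, with $\Phi(\theta)=\Phi(0)e^{J\theta}$ for $\theta\in[-\tau,0]$, and $\Psi$ is an $n\times2$ matrix whose columns span the eigenspace corresponding to $\pm i$ for the adjoint equation $\dot z(t)=-\int_{-\tau}^{0}d\eta^{\top}(\theta)z(t-\theta)$ on $C([0,\tau],\mathbb{R}^n)$.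
   Formalization: Symmetry of h' a.e. is used only when dh is absolutely continuous; otherwise dh itself must be symmetric about the mean (step functions have h'=0 a.e., so the literal condition fails for asymmetric discrete delays). h is normalized to be right-continuous. *)

(* Defs.v *)
From HB Require Import structures.
From mathcomp Require Import all_boot all_order all_algebra.
From mathcomp Require Import all_classical all_reals all_analysis.
From mathcomp Require Import complex.
From mathcomp Require Import ring.

Set Implicit Arguments.
Unset Strict Implicit.
Unset Printing Implicit Defensive.
Import Order.TTheory GRing.Theory Num.Theory.
Import numFieldNormedType.Exports.

Local Open Scope classical_set_scope.
Local Open Scope ring_scope.
Local Open Scope complex_scope.

Section RiemannStieltjes.
Variable R : realType.
Implicit Types (f g : R -> R) (a b : R) (s t : seq R).

(* [s] lists the subdivision points other than [a], as in [itv_partition];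
   [t] lists one tag per subinterval. *)
Definition tagged_partition a b s t : Prop :=
  [/\ itv_partition a b s, size t = size s &
      forall i, (i < size s)%N -> nth a (a :: s) i <= nth a t i <= nth a s i].

Definition RS_sum f g a s t : R :=
  \sum_(i < size s) f (nth a t i) * (g (nth a s i) - g (nth a (a :: s) i)).

Definition is_RS_integral f g a b (I : R) : Prop :=
  forall e : R, 0 < e -> exists2 d : R, 0 < d &
    forall s t, tagged_partition a b s t ->
      (forall i, (i < size s)%N -> nth a s i - nth a (a :: s) i < d) ->
      `|RS_sum f g a s t - I| < e.

(* Arbitrary when the integral does not exist; it does exist for [f] continuous
   and [g] of bounded variation. *)
Definition RS_integral f g a b : R := get (is_RS_integral f g a b).

Definition RS_integralC (f : R -> R[i]) g a b : R[i] :=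
  RS_integral (fun x => complex.Re (f x)) g a b +i*
  RS_integral (fun x => complex.Im (f x)) g a b.

End RiemannStieltjes.

Section LinearFDE.
Variables (R : realType) (n : nat).
Implicit Types (eta : R -> 'M[R]_n) (tau : R) (l : R[i]).

Definition cexp l : R[i] :=
  (expR (complex.Re l) * cos (complex.Im l)) +i*
  (expR (complex.Re l) * sin (complex.Im l)).

Definition iC : R[i] := 0 +i* 1.

(* x(t) = e^(l t) v solves x'(t) = int_[-tau, 0] d eta(th) x(t + th)
   iff [char_mx eta tau l *m v = 0]. *)
Definition char_mx eta tau l : 'M[R[i]]_n :=
  l%:M - \matrix_(j, k) RS_integralC (fun th => cexp (l * th%:C))
                          (fun th => eta th j k) (- tau) 0.

Definition char_value eta tau l : Prop := \det (char_mx eta tau l) = 0.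

(* z(t) = e^(l t) w solves z'(t) = - int_[-tau, 0] d eta^T(th) z(t - th)
   iff [adj_char_mx eta tau l *m w = 0]. *)
Definition adj_char_mx eta tau l : 'M[R[i]]_n :=
  l%:M + \matrix_(j, k) RS_integralC (fun th => cexp (- l * th%:C))
                          (fun th => (eta th)^T j k) (- tau) 0.

(* Given the characteristic matrix [D] of an equation on [a, b], the real
   functions on [a, b] in the span of its eigenfunctions e^(+-i t) v. *)
Definition eigenspace_i (D : R[i] -> 'M[R[i]]_n) a b (phi : R -> 'cV[R]_n)
    : Prop :=
  exists v w : 'cV[R[i]]_n,
    [/\ D iC *m v = 0, D (- iC) *m w = 0 &
        forall t, t \in `[a, b] ->
          map_mx (real_complex R) (phi t)
          = cexp (iC * t%:C) *: v + cexp (- iC * t%:C) *: w].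

Definition columns_span a b (Phi : R -> 'M[R]_(n, 2))
    (E : (R -> 'cV[R]_n) -> Prop) : Prop :=
  forall phi : R -> 'cV[R]_n,
    E phi <-> exists c : 'cV[R]_2, forall t, t \in `[a, b] -> phi t = Phi t *m c.

End LinearFDE.

Definition expmx (R : realType) (m : nat) (A : 'M[R]_m.+1) : 'M[R]_m.+1 :=
  limn (series (fun k => (k`!%:R)^-1 *: A ^+ k)).

Definition J (R : realType) : 'M[R]_2 :=
  \matrix_(i, j) ((j < i)%N%:R - (i < j)%N%:R).

Record critical_linear_equation (R : realType) (n : nat)
    (tau : R) (eta : R -> 'M[R]_n) (Phi Psi : R -> 'M[R]_(n, 2)) : Prop := {
  delay_gt0 : 0 < tau ;
  eta_bv : forall j k, bounded_variation (- tau) 0 (fun th => eta th j k) ;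
  char_value_i : char_value eta tau (iC R) ;
  char_value_Ni : char_value eta tau (- iC R) ;
  char_value_stable : forall l, char_value eta tau l ->
    l != iC R -> l != - iC R -> complex.Re l < 0 ;
  Phi_span :
    columns_span (- tau) 0 Phi (eigenspace_i (char_mx eta tau) (- tau) 0) ;
  Phi_exp : forall th, th \in `[- tau, 0] ->
    Phi th = Phi 0 *m expmx (th *: J R) ;
  Psi_span :
    columns_span 0 tau Psi (eigenspace_i (adj_char_mx eta tau) 0 tau) }.

Section DelayDistribution.
Variable R : realType.
Implicit Types (h : cumulative R R) (tbar mu : R).

(* The measure dh. Distribution functions are normalized to be
   right-continuous, which does not affect dh-integrals of continuous functions
   nor the derivative where it exists. *)
Local Notation d_ h := (lebesgue_stieltjes_measure h).

Definition delay_distribution h tbar (sigma : R) : Prop :=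
  [/\ exists2 K : set R, compact K & d_ h (~` K) = 0%E,
      (\int[d_ h]_th 1 = 1)%E,
      (\int[d_ h]_th th%:E = tbar%:E)%E &
      (\int[d_ h]_th ((th - tbar) ^+ 2)%:E = (sigma ^+ 2)%:E)%E].

(* The derivative of a monotone function exists a.e. but determines dh only when
   dh has no singular part: for a step function it vanishes a.e., and its
   symmetry carries no information. Hence the equation on h' is used when dh is
   absolutely continuous; otherwise symmetry is that of dh itself. *)
Definition symmetric_about_mean h tbar : Prop :=
  [/\ d_ h `<< lebesgue_measure,
      {ae lebesgue_measure, forall th, derivable (h : R -> R) th 1} &
      {ae lebesgue_measure, forall th,
         derive1 (h : R -> R) (tbar + th) = derive1 (h : R -> R) (tbar - th)}]
  \/ (forall A : set R, measurable A ->
        d_ h [set tbar + th | th in A] = d_ h [set tbar - th | th in A]).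

(* For mu <= 0, where the rescaling makes no sense, the Heaviside step at tbar;
   only mu = 0 has a meaning, and alpha, beta treat it separately. *)
Definition dilate h tbar mu (th : R) : R :=
  if 0 < mu then h (tbar + (th - tbar) / mu) else (tbar <= th)%R%:R.

Lemma dilate_nd h tbar mu : {homo dilate h tbar mu : x y / x <= y}.
Proof.
move=> x y xy; rewrite /dilate; case: ifPn => [mu0|_].
  by apply: (cumulative_is_nondecreasing h); rewrite lerD2l ler_pM2r ?invr_gt0// lerD2r.
rewrite ler_nat; have [tx|//] := boolP (tbar <= x)%R.
by rewrite (le_trans tx xy).
Qed.

Lemma dilate_rc h tbar mu : right_continuous (dilate h tbar mu).
Proof.
move=> x; rewrite /dilate; case: ifPn => [mu0|_].
  pose f (th : R) := tbar + (th - tbar) / mu.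
  apply: (cvg_comp f h _ (cumulative_is_right_continuous h (f x))) => A.
  move=> [e /= e0 eA]; exists (e * mu) => /=; first by rewrite mulr_gt0.
  move=> z /= xz ltxz; have fE : f x - f z = (x - z) / mu by rewrite /f; ring.
  apply: eA => /=; last by rewrite /f ltrD2l ltr_pM2r ?invr_gt0// ltrD2r.
  by rewrite fE normrM normfV (gtr0_norm mu0) ltr_pdivrMr.
apply: cvg_near_cst; have [tx|] := leP tbar x.
  by exists 1 => //= z _ xz; rewrite (le_trans tx (ltW xz)).
rewrite -subr_gt0 => xt; exists (tbar - x) => //= z /=; rewrite distrC => dz _.
have := le_lt_trans (ler_norm (z - x)) dz.
by rewrite ltrD2r ltNge => /negbTE ->.
Qed.

HB.instance Definition _ h tbar mu :=
  isCumulative.Build R _ R (dilate h tbar mu)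
    (@dilate_nd h tbar mu) (@dilate_rc h tbar mu).

Definition alpha h tbar mu : R :=
  if mu == 0 then cos tbar
  else \int[d_ (dilate h tbar mu)]_th cos th.

Definition beta h tbar mu : R :=
  if mu == 0 then sin tbar
  else \int[d_ (dilate h tbar mu)]_th sin th.

Definition p h tbar (Chat : 'M[R]_2) mu : R :=
  alpha h tbar mu * \tr Chat + beta h tbar mu * \tr (J R *m Chat).

End DelayDistribution.

(* Main.v *)
(* Let [m] be the measure dh. It is invariant under the reflection
   x |-> 2 tbar - x, and dh_mu is its image under
   th |-> tbar + mu (th - tbar). By the addition formulas, as the odd function
   sin (mu (th - tbar)) has m-integral 0, alpha_mu = k cos tbar and
   beta_mu = k sin tbar where k is the m-integral of cos (mu (th - tbar)).
   Hence p_mu = k p_0 with |k| <= 1. *)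
Require Import Defs.
From HB Require Import structures.
From mathcomp Require Import all_boot all_order all_algebra.
From mathcomp Require Import all_classical all_reals all_analysis.
From mathcomp Require Import measurable_realfun.
From mathcomp Require Import ring lra.
Import Order.TTheory GRing.Theory Num.Theory.
Import numFieldNormedType.Exports.
Local Open Scope classical_set_scope.
Local Open Scope ring_scope.

(** * Lebesgue-Stieltjes measures and their images under affine maps *)

Lemma lebesgue_stieltjes_measure_itvoc {R : realType} (h : cumulative R R)
    (a b : R) : a <= b ->
  lebesgue_stieltjes_measure h `]a, b] = (h b - h a)%:E.
Proof.
move=> ab; rewrite /lebesgue_stieltjes_measure /measure_extension/=.
rewrite measurable_mu_extE/=; last exact: is_ocitv.
by rewrite wlength_itv_bnd.
Qed.

(** A Lebesgue-Stieltjes measure is determined by its values on half-open intervals, so the image of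
    [m] need only be compared with it there. *)
Lemma pushforward_lebesgue_stieltjes {R : realType} (g : cumulative R R)
    (m : {measure set (measurableTypeR R) -> \bar R})
    (phi : R -> R) : measurable_fun [set: R] phi ->
  (forall a b, a < b -> m (phi @^-1` `]a, b]) = (g b - g a)%:E) ->
  forall A, measurable A -> lebesgue_stieltjes_measure g A = m (phi @^-1` A).
Proof.
move=> mphi mE A mA.
apply: (@lebesgue_stieltjes_measure_unique R g
  (pushforward m (phi : measurableTypeR R -> measurableTypeR R))) => //.
move=> _ [[a b] _ <-] /=; rewrite /pushforward.
have [ab|ba] := ltP a b.
  by rewrite mE// lebesgue_stieltjes_measure_itvoc// ltW.
by rewrite set_itv_ge ?bnd_simp -?leNgt// preimage_set0 !measure0.
Qed.

Lemma lebesgue_measure_shift {R : realType} (c : R) (A : set R) :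
  measurable A ->
  lebesgue_measure ((fun x => c + x) @^-1` A) = lebesgue_measure A.
Proof.
move=> mA; apply/esym.
(* Lebesgue measure is the Lebesgue-Stieltjes measure of the identity. *)
apply: (@pushforward_lebesgue_stieltjes R idfun lebesgue_measure) => //.
  exact: measurable_funD.
move=> a b ab.
rewrite (_ : _ @^-1` _ = `]a - c, b - c]%classic).
  rewrite [LHS]lebesgue_measure_itv/= lte_fin ltrD2r ab -EFinB.
  by congr EFin; ring.
by apply/seteqP; split => x /=; rewrite !in_itv/= ltrBlDl lerBrDl.
Qed.

Lemma lebesgue_measure_reflect {R : realType} (c : R) (A : set R) :
  measurable A ->
  lebesgue_measure ((fun x => c - x) @^-1` A) = lebesgue_measure A.
Proof.
move=> mA; apply/esym.
apply: (@pushforward_lebesgue_stieltjes R idfun lebesgue_measure) => //.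
  exact: measurable_funB.
move=> a b ab.
(* The reflection exchanges the open and the closed end but keeps the length. *)
rewrite (_ : _ @^-1` _ = `[c - b, c - a[%classic).
  rewrite [LHS]lebesgue_measure_itv/= lte_fin ltrD2l ltrN2 ab -EFinB.
  by congr EFin; ring.
apply/seteqP; split => x /=; rewrite !in_itv/= => /andP[xa xb];
  by apply/andP; split; lra.
Qed.

(** The argument of [h] in [dilate] is the inverse of the affine map; as [mu > 0] it preserves
    order, so half-open intervals pull back to half-open intervals. *)
Lemma dilate_pushforward {R : realType} (h : cumulative R R) (tbar mu : R) :
  0 < mu -> forall A, measurable A ->
  lebesgue_stieltjes_measure (dilate h tbar mu) A =
  lebesgue_stieltjes_measure h ((fun th => tbar + mu * (th - tbar)) @^-1` A).
Proof.
move=> mu0.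
have dE th : dilate h tbar mu th = h (tbar + (th - tbar) / mu).
  by rewrite /dilate mu0.
apply: pushforward_lebesgue_stieltjes.
  apply: measurable_funD => //; apply: measurable_funM => //.
  exact: measurable_funB.
move=> a b ab; rewrite (_ : _ @^-1` _ =
    `]tbar + (a - tbar) / mu, tbar + (b - tbar) / mu]%classic).
  rewrite [LHS]lebesgue_stieltjes_measure_itvoc.
    by rewrite /= !dE.
  by rewrite lerD2l ler_pM2r ?invr_gt0// lerD2r ltW.
by apply/seteqP; split => x /=; rewrite !in_itv/=;
  rewrite -[a < _]ltrBlDl -[_ <= b]lerBrDl -[_ < x]ltrBrDl -[x <= _]lerBlDl;
  rewrite ltr_pdivrMr// ler_pdivlMr// [mu * _]mulrC.
Qed.

(** * Reflection invariance of the delay distribution *)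

(** Common form to which both cases of [symmetric_about_mean] are reduced; preimages, unlike images,
    fit pushforward measures directly. *)
Definition reflection_invariant {R : realType}
    (m : set (measurableTypeR R) -> \bar R) (tbar : R) :=
  forall A : set R, measurable A -> m ((fun x => tbar *+ 2 - x) @^-1` A) = m A.

(** For [A] translated by [- tbar], the two images in the hypothesis become [A] and its mirror image
    about [tbar]. *)
Lemma reflection_invariant_image {R : realType}
    (m : set (measurableTypeR R) -> \bar R) (tbar : R) :
  (forall A : set R, measurable A ->
     m [set tbar + th | th in A] = m [set tbar - th | th in A]) ->
  reflection_invariant m tbar.
Proof.
move=> mE A mA; have := mE ((fun th => tbar + th) @^-1` A).
have -> : [set tbar + th | th in (fun th => tbar + th) @^-1` A] = A.
  apply/seteqP; split => [_ [x /= Ax <-]//|x Ax]; exists (x - tbar) => //=.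
    by rewrite subrKC.
  by rewrite subrKC.
have -> : [set tbar - th | th in (fun th => tbar + th) @^-1` A] =
    (fun x => tbar *+ 2 - x) @^-1` A.
  apply/seteqP; split => [_ [x /= Ax <-]|x /= Ax] /=.
    by rewrite (_ : tbar *+ 2 - _ = tbar + x)//; ring.
  exists (tbar - x); last by ring.
  by rewrite /= (_ : tbar + _ = tbar *+ 2 - x)//; ring.
move=> -> //; rewrite -[X in measurable X]setTI.
exact: measurable_funD.
Qed.

(** The primitive [F] of [f] has the same increments as [h], so they differ by a constant, and
    [F' = f] almost everywhere. *)
Lemma ae_derive1_lebesgue_stieltjes {R : realType} (h : cumulative R R)
    (f : R -> R) : lebesgue_measure.-integrable [set: R] (EFin \o f) ->
  (forall A : set R, measurable A ->
    lebesgue_stieltjes_measure h A = \int[lebesgue_measure]_(x in A) (f x)%:E)%E ->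
  {ae lebesgue_measure, forall x, derive1 (h : R -> R) x = f x}.
Proof.
move=> intf hE.
have intS (A : set R) :
    measurable A -> lebesgue_measure.-integrable A (EFin \o f).
  by move=> mA; apply: integrableS intf.
pose F x := (\int[lebesgue_measure]_(t in `]-oo, x]) f t)%R.
have FB a b : a <= b -> F b - F a = h b - h a.
  move=> ab; rewrite /F Rintegral_itvB//; last exact: intS.
  by rewrite /Rintegral -hE// lebesgue_stieltjes_measure_itvoc.
have hF : (h : R -> R) = F + cst (h 0 - F 0).
  apply/funext => x; rewrite fctE /=.
  by have [/FB|/ltW/FB] := leP 0 x; lra.
have : {ae lebesgue_measure, forall x, derivable F x 1 /\ derive1 F x = f x}.
  apply: FTC1Ny => [y|]; first exact: intS.
  by apply: open_integrable_locally; first exact: openT.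
apply: filterS; first exact: (ae_filter_ringOfSetsType lebesgue_measure).
move=> x [dF <-].
by rewrite hF !derive1E deriveD// derive_cst addr0.
Qed.

(* By Lebesgue differentiation the density of dh is h', so its symmetry passes
   to dh because Lebesgue measure is invariant under isometries of the line. *)
Lemma reflection_invariant_density {R : realType} (h : cumulative R R)
    (tbar : R) : (lebesgue_stieltjes_measure h [set: R] < +oo)%E ->
  lebesgue_stieltjes_measure h `<< lebesgue_measure ->
  {ae lebesgue_measure, forall th,
     derive1 (h : R -> R) (tbar + th) = derive1 (h : R -> R) (tbar - th)} ->
  reflection_invariant (lebesgue_stieltjes_measure h) tbar.
Proof.
move=> hoo hl hsym.
have aeF := ae_filter_ringOfSetsType (@lebesgue_measure R).
(* Restriction to the whole line leaves dh unchanged but bundles it as a finite measure, ready for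
   Radon-Nikodym. *)
pose m : {finite_measure set (measurableTypeR R) -> \bar R} :=
  mfrestr (@measurableT _ (measurableTypeR R)) hoo.
have mE A : m A = lebesgue_stieltjes_measure h A.
  by rewrite /m /= /mfrestr /mrestr setIT.
have ml : m `<< lebesgue_measure.
  move=> A nA B mB BA; rewrite mE; exact: (hl A nA).
have [f [f0 ffin intf mf]] := radon_nikodym_sigma_finite ml.
have fE : EFin \o (fine \o f) = f by apply/funext => x /=; rewrite fineK.
have hf : {ae lebesgue_measure, forall x, derive1 (h : R -> R) x = fine (f x)}.
  apply: (@ae_derive1_lebesgue_stieltjes R h (fine \o f)); first by rewrite fE.
  move=> A mA; rewrite -mE mf//; apply: eq_integral => x _ /=.
  by rewrite fineK.
(* Almost everywhere statements can be composed with a measure-preserving map: the exceptional null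
   set pulls back to a null set. *)
have shift (P : R -> Prop) (phi : R -> R) : measurable_fun [set: R] phi ->
    (forall A, measurable A ->
      lebesgue_measure (phi @^-1` A) = lebesgue_measure A) ->
    {ae lebesgue_measure, forall x, P x} ->
    {ae lebesgue_measure, forall x, P (phi x)}.
  move=> mphi phiE [N [mN N0 PN]]; exists (phi @^-1` N); split.
  - by rewrite -[X in measurable X]setTI; exact: mphi.
  - by rewrite -[RHS]N0; exact: phiE.
  - by move=> x /= Px; exact: PN.
pose r : measurableTypeR R -> measurableTypeR R := fun x => tbar *+ 2 - x.
have mr : measurable_fun [set: measurableTypeR R] r by exact: measurable_funB.
have rinv := @lebesgue_measure_reflect R (tbar *+ 2).
have fr : {ae lebesgue_measure, forall x, f (r x) = f x}.
  (* Substitute [th = x - tbar] in the symmetry of the derivative. *)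
  have hsym' : {ae lebesgue_measure, forall x,
      derive1 (h : R -> R) x = derive1 (h : R -> R) (r x)}.
    have ms : measurable_fun [set: R] (fun x => - tbar + x).
      exact: measurable_funD.
    have := shift _ _ ms (@lebesgue_measure_shift R (- tbar)) hsym.
    apply: filterS => x.
    rewrite addrA subrr add0r => ->; congr (derive1 _ _).
    by rewrite /r; ring.
  have hr := shift _ r mr rinv hf.
  apply: filterS3 hf hr hsym' => x h1 h2 h3.
  by rewrite -[LHS]fineK// -h2 -h3 h1 fineK.
have mef : measurable_fun [set: measurableTypeR R] f.
  exact: measurable_int intf.
move=> A mA.
have mrA : measurable (r @^-1` A).
  by rewrite -[X in measurable X]setTI; exact: mr.
rewrite -[RHS]mE -[LHS]mE !mf//.
(* Replace [f] by [f \o r], equal to it almost everywhere, then change variables: [r] preserves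
   Lebesgue measure. *)
transitivity (\int[lebesgue_measure]_(x in r @^-1` A) (f \o r) x)%E.
  apply: ae_eq_integral => //.
  - exact: measurable_funTS.
  - by apply: measurable_funTS; exact: measurableT_comp.
  - by apply: filterS fr => x /= ->.
rewrite -ge0_integral_pushforward//.
- by apply: eq_measure_integral => B mB _; exact: rinv.
- exact: measurable_funTS.
Qed.

(** * Integration of bounded continuous functions against finite measures *)

Lemma bounded_continuous_integrable {R : realType}
    (m : {measure set (measurableTypeR R) -> \bar R}) (f : R -> R) (M : R) :
  (m [set: R] < +oo)%E -> continuous f -> (forall x, `|f x| <= M) ->
  m.-integrable [set: R] (EFin \o f).
Proof.
move=> moo cf fM; apply: measurable_bounded_integrable => //.
  exact: continuous_measurable_fun.
exists M; split; first exact: num_real.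
by move=> N MN x _ /=; rewrite (le_trans (fM x))// ltW.
Qed.

Lemma Rintegral_change_of_variable {R : realType}
    (m1 m2 : {measure set (measurableTypeR R) -> \bar R}) (phi f : R -> R)
    (M : R) :
  (forall A, measurable A -> m1 A = m2 (phi @^-1` A)) ->
  (m2 [set: R] < +oo)%E -> continuous phi -> continuous f ->
  (forall x, `|f x| <= M) ->
  \int[m1]_x f x = \int[m2]_x f (phi x).
Proof.
move=> m12 moo cphi cf fM; rewrite /Rintegral; congr fine.
pose psi : measurableTypeR R -> measurableTypeR R := phi.
have mpsi : measurable_fun [set: measurableTypeR R] psi.
  exact: continuous_measurable_fun.
transitivity (\int[pushforward m2 psi]_x (f x)%:E)%E.
  by apply: eq_measure_integral => A mA _; exact: m12.
rewrite integral_pushforward//.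
  by apply/measurable_EFinP; exact: continuous_measurable_fun.
apply: (bounded_continuous_integrable _ _ M) => //.
by move=> x; apply: continuous_comp; [exact: cphi|exact: cf].
Qed.

Lemma continuous_homothety {R : realType} (c t : R) :
  continuous (fun x : R => c * (x - t)).
Proof.
by move=> x; apply: cvgMr; apply: cvgB; [exact: cvg_id|exact: cvg_cst].
Qed.

Lemma continuous_comp_homothety {R : realType} (f : R -> R) (c t : R) :
  continuous f -> continuous (fun x : R => f (c * (x - t))).
Proof.
move=> cf x; apply: (@continuous_comp _ _ _ (fun x : R => c * (x - t)) f).
  exact: continuous_homothety.
exact: cf.
Qed.

(** * Trigonometric integrals against a reflection-invariant measure *)

Lemma normr_cos_le1 {R : realType} (x : R) : `|cos x| <= 1.
Proof. by rewrite ler_norml cos_geN1 cos_le1. Qed.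

Lemma normr_sin_le1 {R : realType} (x : R) : `|sin x| <= 1.
Proof. by rewrite ler_norml sin_geN1 sin_le1. Qed.

(** The reflection turns [x - tbar] into its opposite, so by oddness of [sin] the integral equals
    its own negative. *)
Lemma reflection_invariant_sin {R : realType}
    (m : {measure set (measurableTypeR R) -> \bar R}) (tbar c : R) :
  (m [set: R] < +oo)%E -> reflection_invariant m tbar ->
  \int[m]_x sin (c * (x - tbar)) = 0.
Proof.
move=> moo msym.
have cs := continuous_comp_homothety _ c tbar (@continuous_sin R).
have s1 x := normr_sin_le1 (c * (x - tbar)).
have : \int[m]_x sin (c * (x - tbar)) = - \int[m]_x sin (c * (x - tbar)).
  rewrite {1}(Rintegral_change_of_variable m m (fun x => tbar *+ 2 - x) _ 1)//.
  - rewrite -[RHS]mulN1r -RintegralZl//; last first.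
      exact: (bounded_continuous_integrable _ _ 1).
    by apply: eq_Rintegral => x _; rewrite mulN1r -sinN; congr sin; ring.
  - by move=> A mA; rewrite msym.
  - by move=> x; apply: cvgB; [exact: cvg_cst|exact: cvg_id].
lra.
Qed.

(** A single [k] serves both integrals; this is what lets it factor out of [p]. *)
Lemma reflection_invariant_trig {R : realType}
    (m : {measure set (measurableTypeR R) -> \bar R}) (tbar c : R) :
  m [set: R] = 1%E -> reflection_invariant m tbar ->
  exists2 k : R, `|k| <= 1 &
    \int[m]_x cos (tbar + c * (x - tbar)) = k * cos tbar /\
    \int[m]_x sin (tbar + c * (x - tbar)) = k * sin tbar.
Proof.
move=> m1 msym.
have moo : (m [set: R] < +oo)%E by rewrite m1 ltry.
have intc : m.-integrable [set: R] (EFin \o (fun x => cos (c * (x - tbar)))).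
  apply: (bounded_continuous_integrable _ _ 1) => // [|x].
    exact/continuous_comp_homothety/continuous_cos.
  exact: normr_cos_le1.
have ints : m.-integrable [set: R] (EFin \o (fun x => sin (c * (x - tbar)))).
  apply: (bounded_continuous_integrable _ _ 1) => // [|x].
    exact/continuous_comp_homothety/continuous_sin.
  exact: normr_sin_le1.
have intZ (f : R -> R) k : m.-integrable [set: R] (EFin \o f) ->
    m.-integrable [set: R] (EFin \o (fun x => k * f x)).
  by move=> fi; exact: (integrableZl measurableT k fi).
have s0 := reflection_invariant_sin m tbar c moo msym.
exists (\int[m]_x cos (c * (x - tbar))).
  apply: le_trans (le_normr_Rintegral _ _) _ => //.
  (* The bound 1 is the total mass of [m], so it suffices to compare integrands. *)
  have -> : 1 = \int[m]_(x in [set: R]) (1 : R).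
    by rewrite Rintegral_cst// m1 mul1r.
  apply: le_Rintegral => //.
  - exact: integrable_norm intc.
  - apply: (bounded_continuous_integrable _ _ 1) => // [x|x].
      exact: cvg_cst.
    by rewrite normr1.
  - by move=> x _; exact: normr_cos_le1.
split.
  under eq_Rintegral do rewrite cosD.
  by rewrite RintegralB ?RintegralZl ?s0 ?mulr0 ?subr0 1?mulrC//; exact: intZ.
under eq_Rintegral do rewrite sinD.
by rewrite RintegralD ?RintegralZl ?s0 ?mulr0 ?addr0 1?mulrC//; exact: intZ.
Qed.

Theorem proposition3 (R : realType) (n : nat)
    (tau : R) (eta : R -> 'M[R]_n) (Phi Psi : R -> 'M[R]_(n, 2)) (C : 'M[R]_n)
    (h : cumulative R R) (tbar sigma : R) :
  critical_linear_equation tau eta Phi Psi ->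
  delay_distribution h tbar sigma ->
  symmetric_about_mean h tbar ->
  let Chat := (Psi 0)^T *m C *m Phi 0 in
  forall mu : R, 0 < mu -> `|p h tbar Chat mu| <= `|p h tbar Chat 0|.
Proof.
move=> _ [_ h1 _ _] hsym Chat mu mu0.
have hT : lebesgue_stieltjes_measure h [set: R] = 1%E.
  by rewrite -h1 integral_cst// mul1e.
have hoo : (lebesgue_stieltjes_measure h [set: R] < +oo)%E by rewrite hT ltry.
have hrefl : reflection_invariant (lebesgue_stieltjes_measure h) tbar.
  case: hsym => [[hl _ hder]|him].
    exact: reflection_invariant_density.
  exact: reflection_invariant_image.
have [k k1 [kcos ksin]] := reflection_invariant_trig _ _ mu hT hrefl.
have caff : continuous (fun x : R => tbar + mu * (x - tbar)).
  by move=> x; apply: cvgD; [exact: cvg_cst|exact: continuous_homothety].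
have aE : alpha h tbar mu = k * cos tbar.
  rewrite /alpha gt_eqF// -kcos.
  apply: (Rintegral_change_of_variable _ _ _ _ 1) => //.
  - exact: dilate_pushforward.
  - exact: continuous_cos.
  - exact: normr_cos_le1.
have bE : beta h tbar mu = k * sin tbar.
  rewrite /beta gt_eqF// -ksin.
  apply: (Rintegral_change_of_variable _ _ _ _ 1) => //.
  - exact: dilate_pushforward.
  - exact: continuous_sin.
  - exact: normr_sin_le1.
(* At [mu = 0] the definitions give [cos tbar] and [sin tbar], so pulling out [k] leaves exactly
   [p_0]. *)
rewrite /p aE bE /alpha /beta eqxx -!mulrA -mulrDr normrM.
by rewrite ler_piMl.
Qed.
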